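(* Let $X$, $Y$ be Banach spaces, let $T,S\in B(X,Y)$ and let $T$ be a semi-Fredholm operator with a generalized inverse. Then there is an analytic generalized resolvent for the linear pencil $\lambda\mapsto T-\lambda S$ on a neighborhood of $0$ if and only if there exists a neighborhood $U$ of $0$ such that for all $\lambda\in U$, either $$\dim N(T-\lambda S)=\dim N(T)<\infty\quad\text{or}\quad \operatorname{codim} R(T-\lambda S)=\operatorname{codim} R(T)<\infty.$$
   Context: All spaces are complex. $B(X,Y)$ is the Banach space of bounded linear operators from $X$ to $Y$; $N(\cdot)$ and $R(\cdot)$ denote null space and range. An operator $T\in B(X,Y)$ is semi-Fredholm if $R(T)$ is closed and at least one of $\dim N(T)$, $\operatorname{codim} R(T)$ is finite. A generalized inverse of $T\in B(X,Y)$ is an operator $T^+\in B(Y,X)$ with $TT^+T=T$ and $T^+TT^+=T^+$. For an open set $U\subset\mathbb{C}$, a function $U\ni\lambda\mapsto G(\lambda)\in B(Y,X)$ is a generalized resolvent on $U$ of the linear pencil $\lambda\mapsto T-\lambda S$ if: (i) $(T-\lambda S)G(\lambda)(T-\lambda S)=T-\lambda S$ for all $\lambda\in U$; (ii) $G(\lambda)(T-\lambda S)G(\lambda)=G(\lambda)$ for all $\lambda\in U$; (iii) $G(\lambda)-G(\mu)=(\lambda-\mu)G(\lambda)SG(\mu)$ for all $\lambda,\mu\in U$. It is an analytic generalized resolvent if moreover $\lambda\mapsto G(\lambda)$ is analytic on $U$. Neighborhoods of $0$ are open subsets of $\mathbb{C}$ containing $0$. *)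

(* Defs.v *)
From HB Require Import structures.
From mathcomp Require Import all_boot all_order all_algebra.
From mathcomp Require Import complex.
From mathcomp Require Import all_classical all_reals all_analysis.

Set Implicit Arguments.
Unset Strict Implicit.
Unset Printing Implicit Defensive.

Import Order.TTheory GRing.Theory Num.Theory.
Import numFieldNormedType.Exports.

Local Open Scope classical_set_scope.
Local Open Scope ring_scope.
Local Open Scope complex_scope.

(* Norms of vectors of a complex normed space live in R[i]; they are real, so
   complex.Re recovers the usual real-valued norm. The topology of the complex
   plane is the one of R[i]^o, since R[i] itself carries no topology in the
   library. Membership of f in B(E, F) is expressed by f : {linear E -> F}
   together with bounded_op f. *)
Section operators.
Context {R : realType} {E F : normedModType R[i]}.

Definition bounded_op (f : E -> F) : Prop :=
  exists M : R, forall x : E, complex.Re `|f x| <= M * complex.Re `|x|.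

(* The usual operator norm when f is linear and bounded; the supremum has a
   junk value when f is unbounded. *)
Definition opnorm (f : E -> F) : R :=
  sup [set complex.Re `|f x| | x in [set x : E | complex.Re `|x| <= 1]].

Definition null_space (f : E -> F) : set E := [set x | f x = 0].

Definition dim_is (V : set E) (n : nat) : Prop :=
  exists e : 'I_n -> E,
    [/\ forall i, V (e i),
        forall a : 'I_n -> R[i], \sum_(i < n) a i *: e i = 0 -> forall i, a i = 0
      & forall x, V x -> exists a : 'I_n -> R[i], x = \sum_(i < n) a i *: e i].

(* dim (E / W) = n: the classes modulo W of the e i form a basis of E / W. *)
Definition codim_is (W : set E) (n : nat) : Prop :=
  exists e : 'I_n -> E,
    (forall a : 'I_n -> R[i], W (\sum_(i < n) a i *: e i) -> forall i, a i = 0)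
    /\ (forall x, exists a : 'I_n -> R[i], W (x - \sum_(i < n) a i *: e i)).

End operators.

Section pencils.
Context {R : realType} {X Y : normedModType R[i]}.

Definition semi_fredholm (T : X -> Y) : Prop :=
  closed (range T) /\
  ((exists n, dim_is (null_space T) n) \/ (exists n, codim_is (range T) n)).

Definition generalized_inverse (T : {linear X -> Y}) (P : {linear Y -> X}) :
    Prop :=
  [/\ bounded_op P, forall x, T (P (T x)) = T x & forall y, P (T (P y)) = P y].

Definition pencil (T S : X -> Y) (l : R[i]) : X -> Y := fun x => T x - l *: S x.

Definition generalized_resolvent (T S : X -> Y) (U : set R[i]^o)
    (G : R[i] -> {linear Y -> X}) : Prop :=
  [/\ forall l, U l -> bounded_op (G l),
      forall l, U l -> forall x,
        pencil T S l (G l (pencil T S l x)) = pencil T S l x,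
      forall l, U l -> forall y, G l (pencil T S l (G l y)) = G l y
    & forall l m, U l -> U m -> forall y,
        G l y - G m y = (l - m) *: G l (S (G m y))].

(* Analyticity for the operator norm: around each point of U, G is the sum of a
   power series with coefficients in B(Y, X). *)
Definition analytic_on (U : set R[i]^o) (G : R[i] -> {linear Y -> X}) : Prop :=
  forall l0, U l0 ->
  exists A : nat -> {linear Y -> X},
    (forall k, bounded_op (A k)) /\
    \forall l \near (l0 : R[i]^o),
      opnorm (fun y => G l y - \sum_(k < n) (l - l0) ^+ k *: A k y)
        @[n --> \oo] --> (0 : R).

Definition analytic_generalized_resolvent (T S : X -> Y) (U : set R[i]^o)
    (G : R[i] -> {linear Y -> X}) : Prop :=
  generalized_resolvent T S U G /\ analytic_on U G.

End pencils.

(* Main.v *)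
(* Let P be a generalized inverse of T and A = T - l S. For small l the operator
   B = 1 - l S P is invertible by Neumann series, and so is C = 1 - l P S.
   The function G l = P B^-1 always satisfies (ii) and (iii), and (iii) alone
   forces a generalized resolvent to have this form with P = G 0. Moreover
   N(A) is contained in C^-1 N(T), B R(T) is contained in R(A), and (i) holds
   as soon as one of these inclusions is an equality, while (i) implies both
   equalities. Since C^-1 and B are bijective, equality of the finite
   (co)dimensions is the same as equality of the subspaces. *)
Require Import Defs.
From HB Require Import structures.
From mathcomp Require Import all_boot all_order all_algebra.
From mathcomp Require Import complex.
From mathcomp Require Import all_classical all_reals all_analysis.
From mathcomp Require Import lra.
Set Implicit Arguments.
Unset Strict Implicit.
Unset Printing Implicit Defensive.

Import Order.TTheory GRing.Theory Num.Theory.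
Import numFieldNormedType.Exports.
Local Open Scope classical_set_scope.
Local Open Scope ring_scope.
Local Open Scope complex_scope.

(** * Real-valued norms and operator bounds *)

Section real_norm.
Context {R : realType}.

Definition rnorm {E : normedModType R[i]} (x : E) : R := complex.Re `|x|.

Lemma normE {E : normedModType R[i]} (x : E) : `|x| = (rnorm x)%:C.
Proof. by rewrite [RHS]RRe_real// normr_real. Qed.

Lemma rnorm_ge0 {E : normedModType R[i]} (x : E) : 0 <= rnorm x.
Proof. by rewrite -lecR -normE; exact: normr_ge0. Qed.

Lemma rnorm0 {E : normedModType R[i]} : rnorm (0 : E) = 0.
Proof. by rewrite /rnorm normr0. Qed.

Lemma rnorm_eq0 {E : normedModType R[i]} (x : E) : rnorm x = 0 -> x = 0.
Proof. by move=> x0; apply/eqP; rewrite -normr_eq0 normE x0. Qed.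

Lemma rnormD {E : normedModType R[i]} (x y : E) :
  rnorm (x + y) <= rnorm x + rnorm y.
Proof. by rewrite -lecR rmorphD/= -!normE ler_normD. Qed.

Lemma rnormB {E : normedModType R[i]} (x y : E) : rnorm (x - y) = rnorm (y - x).
Proof. by rewrite /rnorm distrC. Qed.

Lemma rnormZ {E : normedModType R[i]} (a : R[i]) (x : E) :
  rnorm (a *: x) = rnorm (a : R[i]^o) * rnorm x.
Proof. by apply: complexI; rewrite rmorphM/= -!normE normrZ. Qed.

Lemma rnormX (a : R[i]) k : rnorm (a ^+ k : R[i]^o) = rnorm (a : R[i]^o) ^+ k.
Proof. by apply: complexI; rewrite rmorphXn/= -!normE normrX. Qed.

(** Strict positivity of the bound allows the radius [(2 * M)^-1] to be formed later. *)
Lemma bounded_opP {E F : normedModType R[i]} {f : E -> F} :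
  bounded_op f -> exists2 M : R, 0 < M & forall x, rnorm (f x) <= M * rnorm x.
Proof.
move=> [M fM]; exists (`|M| + 1) => [|x]; first by rewrite ltr_wpDl.
apply: (le_trans (fM x)); apply: ler_wpM2r; first exact: rnorm_ge0.
by apply: (le_trans (ler_norm M)); rewrite lerDl.
Qed.

Lemma bounded_op_comp {E F H : normedModType R[i]} (f : F -> H) (g : E -> F) :
  bounded_op f -> bounded_op g -> bounded_op (f \o g).
Proof.
move=> /bounded_opP[M M0 fM] /bounded_opP[N N0 gN]; exists (M * N) => x.
by apply: (le_trans (fM _)); rewrite -mulrA ler_pM2l//; exact: gN.
Qed.

Lemma opnorm_bounds {E F : normedModType R[i]} (f : E -> F) (c : R) :
  0 <= c -> (forall x, rnorm (f x) <= c * rnorm x) -> 0 <= opnorm f <= c.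
Proof.
move=> c0 fc; set A := [set complex.Re `|f x| | x in [set x : E | rnorm x <= 1]].
have A0 : A (rnorm (f 0)) by exists 0 => //=; rewrite rnorm0.
have Ac : ubound A c.
  move=> _ [x /= x1 <-]; apply: (le_trans (fc x)).
  by rewrite -[leRHS]mulr1 ler_wpM2l.
apply/andP; split; last by apply: ge_sup => //; exists (rnorm (f 0)).
apply: (le_trans (rnorm_ge0 (f 0))); apply: ub_le_sup => //; by exists c.
Qed.

End real_norm.

(** * Inversion of 1 - K for a contraction K of a Banach space *)

Section neumann.
Context {R : realType}.

Lemma geometric_small (c e : R) : 0 < e -> exists m, c * (2^-1) ^+ m < e.
Proof.
move=> e0; have [c0|c0] := ltP 0 c; last first.
  by exists 0%N; rewrite expr0 mulr1; apply: le_lt_trans e0.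
have := archi_boundP (divr_ge0 (ltW c0) (ltW e0)); set m := Num.bound _ => cem.
exists m; rewrite exprVn ltr_pdivrMr ?exprn_gt0// mulrC -ltr_pdivrMr//.
by apply: (lt_trans cem); rewrite -natrX ltr_nat ltn_expl.
Qed.

(** Serves for maps obtained by choice, whose linearity is only proved afterwards. *)
Lemma linear_bundle {E F : lmodType R[i]} (f : E -> F) :
  linear f -> exists g : {linear E -> F}, forall x, g x = f x.
Proof.
move=> fl; pose m := GRing.isLinear.Build _ _ _ _ f fl.
pose g : {linear E -> F} := HB.pack f m.
by exists g.
Qed.

(** Iterating [x |-> y + K x] from 0 produces the partial sums of the Neumann series; completeness
    supplies the limit. *)
Lemma contraction_solve {E : completeNormedModType R[i]} (K : {linear E -> E})
    (y : E) : (forall x, rnorm (K x) <= 2^-1 * rnorm x) ->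
  exists x, x - K x = y.
Proof.
move=> hK; pose s n := iter n (fun x => y + K x) 0.
have s_le n : rnorm (s n) <= 2 * rnorm y.
  elim: n => [|n IH] /=; first by rewrite rnorm0 mulr_ge0// rnorm_ge0.
  have := rnormD y (K (s n)); have := hK (s n); lra.
(* Each induction step strips one [K] from both iterates and gains a factor 1/2; the base case is
   the uniform bound [s_le]. *)
have s_dist m n : rnorm (s m - s (m + n)%N) <= 2 * rnorm y * (2^-1) ^+ m.
  elim: m => [|m IH].
    by rewrite add0n expr0 mulr1 sub0r /rnorm normrN; exact: s_le.
  rewrite addSn /= opprD addrACA subrr add0r -linearB exprS.
  apply: (le_trans (hK _)); rewrite mulrCA; apply: ler_wpM2l => //.
have : cvgn (s : nat -> E).
  apply: cauchy_cvg; apply: cauchy_exP => e e0.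
  have [eE Re0] : e = (complex.Re e)%:C /\ 0 < complex.Re e.
    have eE : e = (complex.Re e)%:C by rewrite RRe_real// gtr0_real.
    by split=> //; rewrite -ltcR -eE.
  have [m hm] := geometric_small (2 * rnorm y) Re0.
  exists (s m), m => //= n /= mn.
  rewrite -ball_normE /= normE eE ltcR.
  by apply: le_lt_trans hm; rewrite -(subnKC mn).
set x := lim _ => sx.
exists x; apply/subr0_eq/rnorm_eq0/eqP; rewrite eq_le rnorm_ge0 andbT.
apply/ler_addgt0Pr => e e0; rewrite add0r.
have e2 : 0 < (e / 2)%:C by rewrite ltcR divr_gt0.
move/cvgrPdist_lt : sx => /(_ _ e2)[N _ hN].
have h1 := hN N (leqnn N); have h2 := hN N.+1 (leqnSn N).
rewrite /= normE ltcR in h1; rewrite /= normE ltcR in h2.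
(* The residual is split through [s N.+1 = y + K (s N)]; the two pieces are below e/2 and e/4. *)
have -> : x - K x - y = (x - (y + K (s N))) + K (s N - x).
  by rewrite linearB opprD !addrA subrK addrAC.
have := rnormD (x - (y + K (s N))) (K (s N - x)).
have := hK (s N - x); rewrite rnormB; lra.
Qed.

(** Injectivity of 1 - K makes the chosen solution map linear and a left inverse. *)
Lemma neumann_inverse {E : completeNormedModType R[i]} (K : {linear E -> E}) :
  (forall x, rnorm (K x) <= 2^-1 * rnorm x) ->
  exists L : {linear E -> E},
    [/\ bounded_op L, forall y, L y - K (L y) = y & forall x, L (x - K x) = x].
Proof.
move=> hK; have [f fK] := choice (fun y => contraction_solve y hK).
have inj u v : u - K u = v - K v -> u = v.
  move=> uv; apply/subr0_eq/rnorm_eq0; have := hK (u - v).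
  have -> : K (u - v) = u - v.
    apply/esym/subr0_eq; rewrite linearB -[RHS](subrr (u - K u)) {2}uv.
    by rewrite !opprB addrACA [RHS]addrACA [- v + _]addrC [- K u + _]addrC.
  have := rnorm_ge0 (u - v); lra.
have fl : linear f.
  move=> a u v; apply: inj; rewrite fK linearP opprD addrACA -scalerBr.
  by rewrite !fK.
have [L Lf] := linear_bundle fl.
exists L; split=> [|y|x]; last 2 first.
- by rewrite !Lf fK.
- by apply: inj; rewrite !Lf fK.
(* The bound 2 comes from |L y| <= |y| + |L y| / 2. *)
exists 2 => y; change (rnorm (L y) <= 2 * rnorm y).
have := rnormD (L y - K (L y)) (K (L y)).
rewrite subrK !Lf fK; have := hK (f y); lra.
Qed.

End neumann.

(** * Dimension, codimension and comparison of nested subspaces *)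

Section dimension.
Context {R : realType}.

Definition linear_subspace {E : lmodType R[i]} (V : set E) : Prop :=
  V 0 /\ forall a u v, V u -> V v -> V (a *: u + v).

Lemma subspaceB {E : lmodType R[i]} (V : set E) u v :
  linear_subspace V -> V u -> V v -> V (u - v).
Proof. by move=> [_ sV] Vu Vv; rewrite addrC -scaleN1r; exact: sV. Qed.

Lemma subspace_sum {E : lmodType R[i]} (V : set E) n (a : 'I_n -> R[i]) e :
  linear_subspace V -> (forall i, V (e i)) -> V (\sum_(i < n) a i *: e i).
Proof.
move=> [V0 sV] Ve; elim/big_ind : _ => // [u v Vu Vv|i _].
  by rewrite -[u]scale1r; exact: sV.
by rewrite -[_ *: _]addr0; exact: sV.
Qed.

Lemma subspace_null {E F : lmodType R[i]} (f : {linear E -> F}) :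
  linear_subspace [set x | f x = 0].
Proof.
by split=> [|a u v /= fu fv]; rewrite /= ?linear0// linearP fu fv scaler0 addr0.
Qed.

Lemma subspace_image {E F : lmodType R[i]} (f : {linear E -> F}) (V : set E) :
  linear_subspace V -> linear_subspace (f @` V).
Proof.
move=> [V0 sV]; split=> [|a _ _ [u Vu <-] [v Vv <-]].
  by exists 0; rewrite ?linear0.
by exists (a *: u + v); [exact: sV | rewrite linearP].
Qed.

Lemma subspace_range {E F : lmodType R[i]} (f : {linear E -> F}) :
  linear_subspace (range f).
Proof. exact: subspace_image. Qed.

Lemma sum_mulmx {E : lmodType R[i]} n m (u : 'rV[R[i]]_n) (M : 'M[R[i]]_(n, m))
    (f : 'I_m -> E) :
  \sum_i u 0 i *: (\sum_j M i j *: f j) = \sum_j (u *m M) 0 j *: f j.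
Proof.
under eq_bigr do rewrite scaler_sumr.
rewrite exchange_big; apply: eq_bigr => j _; rewrite mxE scaler_suml.
by apply: eq_bigr => i _; rewrite scalerA.
Qed.

Lemma dim_is_image {E F : normedModType R[i]} (f : {linear E -> F})
    (V : set E) n :
  (forall x, f x = 0 -> x = 0) -> dim_is V n -> dim_is (f @` V) n.
Proof.
move=> finj [e [Ve efree espan]]; exists (f \o e); split=> [i|a fa0|_ [x Vx <-]].
- by exists (e i).
- apply: efree; apply: finj; rewrite linear_sum -[RHS]fa0.
  by apply: eq_bigr => i _; rewrite linearZ.
- have [a ->] := espan _ Vx; exists a; rewrite linear_sum.
  by apply: eq_bigr => i _; rewrite linearZ.
Qed.

Lemma codim_is_image {E F : normedModType R[i]} (f : {linear E -> F})
    (W : set E) n : bijective f -> codim_is W n -> codim_is (f @` W) n.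
Proof.
move=> [g gK fK] [e [efree espan]].
have fsum (a : 'I_n -> R[i]) :
    \sum_(i < n) a i *: f (e i) = f (\sum_(i < n) a i *: e i).
  by rewrite linear_sum; apply: eq_bigr => i _; rewrite linearZ.
exists (f \o e); split=> [a|y].
  by rewrite /= fsum => -[x Wx /(can_inj gK) xE]; apply: efree; rewrite -xE.
have [a Wa] := espan (g y); exists a; rewrite /= fsum.
by exists (g y - \sum_(i < n) a i *: e i) => //; rewrite linearB fK.
Qed.

(** The square matrix [M] writes the basis of [V] in that of [W]. Independence of the former makes
    [M] invertible, so every combination of the [f j] is one of the [e i]. *)
Lemma dim_is_subset {E : normedModType R[i]} (V W : set E) n :
  linear_subspace V -> V `<=` W -> dim_is V n -> dim_is W n -> W `<=` V.
Proof.
move=> sV VW [e [Ve efree _]] [f [_ _ fspan]].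
have [a ea] := choice (fun i => fspan _ (VW _ (Ve i))).
pose M := \matrix_(i, j) a i j.
have eM (u : 'rV_n) : \sum_i u 0 i *: e i = \sum_j (u *m M) 0 j *: f j.
  rewrite -sum_mulmx; apply: eq_bigr => i _; rewrite ea.
  by congr (_ *: _); apply: eq_bigr => j _; rewrite mxE.
have Mu : M \in unitmx.
  rewrite -row_free_unit; apply: inj_row_free => u uM0.
  apply/rowP => i; rewrite mxE.
  apply: (efree (u 0)); rewrite eM uM0 big1// => j _; by rewrite mxE scale0r.
move=> x /fspan[b ->]; have := eM ((\row_j b j) *m invmx M).
rewrite mulmxKV//; under [RHS]eq_bigr do rewrite mxE.
by move=> <-; apply: subspace_sum.
Qed.

(** Modulo [V], [M] writes the [f i] in terms of the [e j]. It is invertible because the [f i] are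
    independent modulo [W], so the [f i] also span modulo [V]. For [x] in [W] the coefficients then
    vanish, again by independence modulo [W]. *)
Lemma codim_is_subset {E : normedModType R[i]} (V W : set E) n :
  linear_subspace V -> linear_subspace W -> V `<=` W ->
  codim_is V n -> codim_is W n -> W `<=` V.
Proof.
move=> sV sW VW [e [_ espan]] [f [ffree _]].
have [a fa] := choice (fun i => espan (f i)).
pose M := \matrix_(i, j) a i j.
have fM (u : 'rV_n) : V (\sum_i u 0 i *: f i - \sum_j (u *m M) 0 j *: e j).
  rewrite -sum_mulmx -sumrB; under eq_bigr do rewrite -scalerBr.
  apply: subspace_sum => // i; under eq_bigr do rewrite mxE.
  exact: fa.
have Mu : M \in unitmx.
  rewrite -row_free_unit; apply: inj_row_free => u uM0.
  apply/rowP => i; rewrite mxE.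
  apply: (ffree (u 0)); apply: VW; have := fM u; rewrite uM0.
  under [X in _ - X]eq_bigr do rewrite mxE scale0r.
  by rewrite sumr_const mul0rn subr0.
move=> x Wx; have [c Vc] := espan x.
have := fM ((\row_j c j) *m invmx M); set u := _ *m invmx M.
rewrite mulmxKV//; under [X in _ - X]eq_bigr do rewrite mxE.
move=> Vu; have Vx : V (x - \sum_i u 0 i *: f i).
  rewrite (_ : _ - _ = (x - \sum_(i < n) c i *: e i) -
    (\sum_i u 0 i *: f i - \sum_(i < n) c i *: e i)).
    exact: subspaceB.
  by rewrite opprB addrA subrK.
have u0 : u 0 =1 (fun=> 0).
  apply: ffree; rewrite -[X in W X](subKr x).
  by apply: subspaceB => //; exact: VW.
move: Vx; under eq_bigr do rewrite u0 scale0r.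
by rewrite sumr_const mul0rn subr0.
Qed.

End dimension.

(** * Algebra of the perturbed pencil at a fixed [l], with [L] inverse to [B] *)

Section pencil_perturbation.
Context {R : realType} {X Y : normedModType R[i]}.
Variables (T S : {linear X -> Y}) (P : {linear Y -> X}) (l : R[i]).
Variable L : {linear Y -> Y}.
Hypothesis TPT : forall x, T (P (T x)) = T x.
Hypothesis PTP : forall y, P (T (P y)) = P y.
Hypothesis BL : forall y, L y - l *: S (P (L y)) = y.
Hypothesis LB : forall y, L (y - l *: S (P y)) = y.

Let A := pencil T S l.
Let B : {linear Y -> Y} := idfun \- (l \*: (S \o P)).
(** [D] is the inverse of C = 1 - l P S, by the identity C^-1 = 1 + l P B^-1 S. *)
Let D : {linear X -> X} := idfun \+ (l \*: (P \o (L \o S))).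

Let SPL y : l *: S (P (L y)) = L y - y.
Proof. by rewrite -[X in _ - X](BL y) subKr. Qed.

(** [B] fixes the null space of [P] pointwise, hence so does [L]. *)
Let PL0 y : P y = 0 -> P (L y) = 0.
Proof. by move=> Py; have := LB y; rewrite Py linear0 scaler0 subr0 => ->. Qed.

Let SD x : S (D x) = L (S x).
Proof. by rewrite /= linearD linearZ /= SPL addrC subrK. Qed.

Let DC x : D (x - l *: P (S x)) = x.
Proof. by rewrite /= [S (x - _)]linearB [S (l *: _)]linearZ /= LB subrK. Qed.

Let D_inj x : D x = 0 -> x = 0.
Proof.
move=> /[dup] /(congr1 S); rewrite SD linear0 /= => ->.
by rewrite linear0 scaler0 addr0.
Qed.

Let B_bij : bijective B. Proof. by exists L => y /=; rewrite ?BL ?LB. Qed.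

(** The defect of [P \o L] as a right inverse of [A] is (1 - T P) L y, which [P] kills. *)
Let APL y : A (P (L y)) = y - (L y - T (P (L y))).
Proof. by rewrite /A /pencil SPL !opprB addrCA. Qed.

Lemma pencil_outer y : P (L (A (P (L y)))) = P (L y).
Proof.
rewrite APL linearB linearB [P (L (L y - _))]PL0 ?subr0//.
by rewrite linearB PTP subrr.
Qed.

(** If A x = 0 then T x = l S x, so C x = x - P T x lies in N(T). *)
Let null_subset : null_space A `<=` D @` null_space T.
Proof.
rewrite /A => x /= /subr0_eq Tx; exists (x - l *: P (S x)); last exact: DC.
by rewrite /null_space /= -linearZ -Tx linearB TPT subrr.
Qed.

Let range_subset : B @` range T `<=` range A.
Proof.
move=> _ [_ [x _ <-] <-]; exists (P (T x)) => //=.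
by rewrite /A /pencil TPT.
Qed.

(** For T x = 0, A D x = - l (1 - T P) L S x is killed by [P], hence by [P \o L]; the inner identity
    then forces A D x = 0. *)
Lemma inner_pencil_dim n :
  (forall x, A (P (L (A x))) = A x) ->
  dim_is (null_space T) n -> dim_is (null_space A) n.
Proof.
move=> AGA /(dim_is_image D_inj); congr (dim_is _ _).
apply/seteqP; split=> // _ [x Tx <-]; change (A (D x) = 0).
rewrite -AGA PL0; first by rewrite /A /pencil !linear0 addr0.
rewrite /A /pencil SD [T (D x)]linearD /= Tx add0r linearZ -scalerBr linearZ.
by rewrite linearB PTP subrr /= scaler0.
Qed.

(** Under the inner identity the defect in [APL] vanishes at A x, so L A x lies in R(T), and A x = B
    L A x. *)
Lemma inner_pencil_codim n :
  (forall x, A (P (L (A x))) = A x) ->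
  codim_is (range T) n -> codim_is (range A) n.
Proof.
move=> AGA /(codim_is_image B_bij); congr (codim_is _ _).
apply/seteqP; split=> // _ [x _ <-].
have TPw : L (A x) = T (P (L (A x))).
  have /(congr1 (fun y => A x - y)) := APL (A x).
  by rewrite AGA subrr subKr => /esym/subr0_eq.
exists (L (A x)); last by rewrite /= BL.
by rewrite TPw; exists (P (L (A x))).
Qed.

Lemma dim_pencil_inner n :
  dim_is (null_space T) n -> dim_is (null_space A) n ->
  forall x, A (P (L (A x))) = A x.
Proof.
move=> /(dim_is_image D_inj) dT dA x.
have sA : linear_subspace (null_space A).
  exact: (subspace_null (T \- l \*: S)).
have := dim_is_subset sA null_subset dA dT; move/(_ (x - P (L (A x)))).
have AB u v : A (u - v) = A u - A v := linearB (T \- l \*: S) u v.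
rewrite /null_space /= AB => h; apply/esym/subr0_eq/h.
(* The witness is C applied to x - P L A x; it simplifies to x - P T x, which [T] annihilates. *)
exists (x - P (L (A x)) - l *: P (S (x - P (L (A x))))); last exact: DC.
rewrite -linearZ [S (x - _)]linearB scalerBr SPL /=.
rewrite -addrA -opprD -linearD opprB addrCA [L (A x) + _]addrC subrK.
by rewrite /A /pencil [_ + (T x - _)]addrC subrK /null_space /= linearB TPT subrr.
Qed.

(** Equal codimensions give A x = B T z for some z; then L A x = T z, and A P T z = B T z. *)
Lemma codim_pencil_inner n :
  codim_is (range T) n -> codim_is (range A) n ->
  forall x, A (P (L (A x))) = A x.
Proof.
move=> /(codim_is_image B_bij) dT dA x.
have sT : linear_subspace (B @` range T).
  exact/subspace_image/subspace_range.
have sA : linear_subspace (range A) := subspace_range (T \- l \*: S).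
have AAx : range A (A x) by exists x.
have [_ [z _ <-] <-] := codim_is_subset sT sA range_subset dT dA AAx.
by rewrite [L _]LB /A /pencil TPT.
Qed.

End pencil_perturbation.

(** * Inverses for small parameters, analyticity and the resolvent identity *)

Section resolvent.
Context {R : realType}.

Lemma bounded_op_inverse_near0 {E : completeNormedModType R[i]}
    (K : {linear E -> E}) : bounded_op K ->
  exists2 r : R, 0 < r & forall l : R[i], rnorm (l : R[i]^o) < r ->
    exists L : {linear E -> E},
    [/\ bounded_op L, forall y, L y - l *: K (L y) = y
      & forall y, L (y - l *: K y) = y].
Proof.
(* This radius makes [l \*: K] a contraction of ratio 1/2. *)
move=> /bounded_opP[M M0 KM]; exists (2 * M)^-1 => [|l lr].
  by rewrite invr_gt0 mulr_gt0.
apply: (@neumann_inverse _ _ (l \*: K)) => x /=.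
rewrite rnormZ; apply: (@le_trans _ _ ((2 * M)^-1 * (M * rnorm x))).
  by apply: ler_pM; rewrite ?rnorm_ge0// ltW.
by rewrite invfM -mulrA mulKf// gt_eqF.
Qed.

Lemma ball0E (r : R) (l : R[i]) :
  ball (0 : R[i]^o) r%:C l = (rnorm (l : R[i]^o) < r) :> Prop.
Proof. by rewrite -ball_normE /= sub0r normrN normE ltcR. Qed.

Lemma near_rnorm_lt (l0 : R[i]) (r : R) : 0 < r ->
  \forall l \near (l0 : R[i]^o), rnorm (l - l0 : R[i]^o) < r.
Proof.
move=> r0; have r0' : 0 < r%:C by rewrite ltcR.
apply: (@filterS _ (nbhs (l0 : R[i]^o)) _ _ _ _
  (nbhsx_ballx (l0 : R[i]^o) _ r0')) => l.
by rewrite -ball_normE /= normE ltcR rnormB.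
Qed.

Fixpoint op_iter {E : lmodType R[i]} (K : {linear E -> E}) n : {linear E -> E} :=
  if n is n'.+1 then op_iter K n' \o K else idfun.

Lemma op_iterS {E : lmodType R[i]} (K : {linear E -> E}) n x :
  op_iter K n.+1 x = K (op_iter K n x).
Proof. by elim: n x => // n IH x; rewrite /= -IH. Qed.

Lemma op_iter_bound {E : normedModType R[i]} (K : {linear E -> E}) (M : R) n :
  0 <= M -> (forall x, rnorm (K x) <= M * rnorm x) ->
  forall x, rnorm (op_iter K n x) <= M ^+ n * rnorm x.
Proof.
move=> M0 KM; elim: n => [|n IH] x; first by rewrite expr0 mul1r.
rewrite op_iterS exprS -mulrA; apply: (le_trans (KM _)).
exact: ler_wpM2l.
Qed.

(* Iterating G l = G l0 + (l - l0) G l S G l0 gives the partial sums of the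
   power series of G at l0 with an explicit geometric remainder. *)
Lemma generalized_resolvent_expansion {X Y : normedModType R[i]}
    (T S : {linear X -> Y}) (U : set R[i]^o) (G : R[i] -> {linear Y -> X}) l l0 :
  generalized_resolvent T S U G -> U l -> U l0 -> forall n y,
  G l y - \sum_(k < n) (l - l0) ^+ k *: G l0 (op_iter (S \o G l0) k y) =
  (l - l0) ^+ n *: G l (op_iter (S \o G l0) n y).
Proof.
move=> [_ _ _ Gres] Ul Ul0; elim=> [|n IH] y.
  by rewrite big_ord0 subr0 expr0 scale1r.
rewrite op_iterS big_ord_recr/= opprD addrA IH -scalerBr Gres//.
by rewrite scalerA -exprSr.
Qed.

(** The coefficients are G l0 (S G l0)^k. With [M] bounding S G l0 and [N] bounding G l, the
    remainder is at most N / 2^n once |l - l0| < 1 / (2 M). *)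
Lemma generalized_resolvent_analytic {X Y : normedModType R[i]}
    (T S : {linear X -> Y}) (U : set R[i]^o) (G : R[i] -> {linear Y -> X}) :
  open U -> bounded_op S -> generalized_resolvent T S U G -> analytic_on U G.
Proof.
move=> oU bS gG l0 Ul0; have [bG _ _ _] := gG.
have [M M0 SGM] := bounded_opP (bounded_op_comp bS (bG _ Ul0)).
pose A k : {linear Y -> X} := G l0 \o op_iter (S \o G l0) k.
exists A; split=> [k|].
  apply: bounded_op_comp; first exact: bG.
  by exists (M ^+ k); apply: op_iter_bound => //; exact: ltW.
have M20 : 0 < (2 * M)^-1 by rewrite invr_gt0 mulr_gt0.
near=> l; have Ul : U l by near: l; exact: open_nbhs_nbhs.
have lr : rnorm (l - l0 : R[i]^o) < (2 * M)^-1.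
  by near: l; exact: near_rnorm_lt.
have [N N0 GN] := bounded_opP (bG _ Ul).
have rem_bounds n : 0 <= opnorm (fun y => G l y -
    \sum_(k < n) (l - l0) ^+ k *: A k y) <= N * 2^-1 ^+ n.
  apply: opnorm_bounds => [|y]; first by rewrite mulr_ge0 ?exprn_ge0// ltW.
  rewrite (generalized_resolvent_expansion gG)// rnormZ rnormX.
  apply: (@le_trans _ _ ((2 * M)^-1 ^+ n * (N * (M ^+ n * rnorm y)))).
    apply: ler_pM; rewrite ?exprn_ge0 ?rnorm_ge0//.
      by apply: lerXn2r; rewrite ?nnegrE ?rnorm_ge0// ltW.
    apply: (le_trans (GN _)); rewrite ler_pM2l//.
    by apply: op_iter_bound => //; exact: ltW.
  rewrite mulrCA -[leRHS]mulrA ler_pM2l// mulrA -exprMn invfM.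
  by rewrite divfK ?gt_eqF.
apply: (@squeeze_cvgr _ _ _ _ (fun=> 0) (fun n => N * 2^-1 ^+ n)).
- exact: nearW.
- exact: cvg_cst.
- by apply: (@cvg_geometric R N 2^-1); rewrite ger0_norm// invf_lt1// ltr1n.
Unshelve. all: by end_near. Qed.

(** With w = Lm y, one has y = w - m S P w and w = Ll (w - l S P w); subtracting inside P Ll leaves
    (l - m) S P w. *)
Lemma neumann_resolvent_identity {X Y : normedModType R[i]}
    (S : {linear X -> Y}) (P : {linear Y -> X}) (l m : R[i])
    (Ll Lm : {linear Y -> Y}) :
  (forall y, Ll (y - l *: S (P y)) = y) ->
  (forall y, Lm y - m *: S (P (Lm y)) = y) ->
  forall y, P (Ll y) - P (Lm y) = (l - m) *: P (Ll (S (P (Lm y)))).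
Proof.
move=> LlB BLm y; move: (Lm y) (BLm y) => w <-.
rewrite -[X in _ - P X](LlB w) -!linearZ -linearB -[_ - Ll _]linearB.
by rewrite opprB addrC addrA subrK scalerBl !linearB.
Qed.

End resolvent.

Theorem theorem2p5 (R : realType) (X Y : completeNormedModType R[i])
    (T S : {linear X -> Y}) (bT : bounded_op T) (bS : bounded_op S)
    (sfT : semi_fredholm T)
    (giT : exists P : {linear Y -> X}, generalized_inverse T P) :
  (exists (U : set R[i]^o) (G : R[i] -> {linear Y -> X}),
     [/\ open U, U 0 & analytic_generalized_resolvent T S U G])
  <->
  (exists U : set R[i]^o,
     [/\ open U, U 0 &
      forall l, U l ->
        (exists n : nat, dim_is (null_space (pencil T S l)) n /\
                         dim_is (null_space T) n)
        \/
        (exists n : nat, codim_is (range (pencil T S l)) n /\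
                         codim_is (range T) n)]).
Proof.
have pencil0 : pencil T S 0 = T.
  by apply/funext => x; rewrite /pencil scale0r subr0.
have open_ball0 (r : R) : open (ball (0 : R[i]^o) r%:C).
  exact: ball_open.
have ball00 (r : R) : 0 < r -> ball (0 : R[i]^o) r%:C 0.
  by move=> r0; rewrite ball0E rnorm0.
split=> [[U [G [oU U0 [[bG GI GO Gres] _]]]]|[U [oU U0 dimU]]].
- pose P := G 0.
  have TPT x : T (P (T x)) = T x by have := GI _ U0 x; rewrite pencil0.
  have PTP y : P (T (P y)) = P y by have := GO _ U0 y; rewrite pencil0.
  have [r r0 invB] :=
    bounded_op_inverse_near0 (K := S \o P) (bounded_op_comp bS (bG _ U0)).
  exists (U `&` ball (0 : R[i]^o) r%:C); split=> [||l [Ul]].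
  + exact: openI.
  + by split=> //; exact: ball00.
  rewrite ball0E => /invB[L [_ BL LB]].
  (* Identity (iii) between l and 0, applied at L y, turns G l (L y - l S P L y) into P L y. *)
  have GE y : G l y = P (L y).
    have := Gres _ _ Ul U0 (L y); rewrite subr0 => GlP.
    by rewrite -{1}[y]BL linearB linearZ /= -GlP subKr.
  have AGA x : pencil T S l (P (L (pencil T S l x))) = pencil T S l x.
    by rewrite -GE GI.
  (* The finite one among the dimension and codimension of [T] selects the alternative, uniformly in
     [l]. *)
  have [_ [[n dT]|[n dT]]] := sfT.
  + by left; exists n; split=> //; exact: (inner_pencil_dim TPT PTP BL LB).
  + by right; exists n; split=> //; exact: (inner_pencil_codim TPT BL LB).
- have [P [bP TPT PTP]] := giT.
  have [r r0 invB] :=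
    bounded_op_inverse_near0 (K := S \o P) (bounded_op_comp bS bP).
  (* Choice needs a value for every [l]; outside the disc it is the identity, a default never
     evaluated on [V]. *)
  have /choice[L LP] : forall l, exists L : {linear Y -> Y},
      rnorm (l : R[i]^o) < r ->
      [/\ bounded_op L, forall y, L y - l *: S (P (L y)) = y
        & forall y, L (y - l *: S (P y)) = y].
    move=> l; have [/invB[L LP]|_] := boolP (rnorm (l : R[i]^o) < r).
      by exists L.
    by exists idfun.
  pose G l : {linear Y -> X} := P \o L l.
  pose V := U `&` ball (0 : R[i]^o) r%:C.
  have oV : open V by exact: openI.
  have gG : generalized_resolvent T S V G.
    split=> [l [_]|l [Ul]|l [_]|l m [_ +] [_]].
    - by rewrite ball0E => /LP[bL _ _]; exact: bounded_op_comp.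
    - rewrite ball0E => /LP[_ BL LB]; have [[n [dA dT]]|[n [dA dT]]] := dimU _ Ul.
      + exact: (dim_pencil_inner TPT BL LB dT dA).
      + exact: (codim_pencil_inner TPT BL LB dT dA).
    - by rewrite ball0E => /LP[_ BL LB]; exact: (pencil_outer PTP BL LB).
    - rewrite !ball0E => /LP[_ _ LB] /LP[_ BL _].
      exact: neumann_resolvent_identity.
  exists V, G; split=> //; first by split=> //; exact: ball00.
  by split=> //; exact: generalized_resolvent_analytic gG.
Qed.
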